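(* Let $n\in\mathbb N$, $f:\mathbb B^n\to\mathbb B$, and let $X\in\mathcal{IS}_{br}$ compute $f$. Then there exists $Y\in\mathcal{IS}_{br}$ in which the basic instruction $\mathtt{out}.\mathtt{set{:}F}$ does not occur such that $Y$ computes $f$ and $|Y|$ is linear in $|X|$ (bounded by a linear function of $|X|$ whose constants do not depend on $n$, $f$, $X$).
   Context: Let $\mathbb B=\{\mathsf T,\mathsf F\}$. There are Boolean registers named $\mathtt{in}{:}i$ ($i\ge1$), $\mathtt{aux}{:}i$ ($i\ge1$) and $\mathtt{out}$, processing methods $\mathtt{set{:}T}$ (content becomes $\mathsf T$, reply $\mathsf T$), $\mathtt{set{:}F}$ (content becomes $\mathsf F$, reply $\mathsf F$), $\mathtt{get}$ (no change, reply is the content). Basic instructions are $f.m$ ($f$ register name, $m$ method). Primitive instructions: for each basic instruction $a$, the plain instruction $a$, positive test $+a$, negative test $-a$; forward jumps $\#l$ ($l\in\mathbb N$); termination $!$. An instruction sequence is a finite non-empty sequence $X=u_1;\dots;u_k$ of primitive instructions, $|X|=k$. Execution starts at $u_1$: $a$ executes $a$ and proceeds with the next instruction; $+a$ executes $a$ and proceeds with the next instruction if the reply is $\mathsf T$, otherwise skips the next instruction and proceeds with the one after; $-a$ likewise with reply roles reversed; $\#l$ proceeds with the $l$-th next instruction ($\#0$ causes inaction); $!$ terminates; if there is no instruction to proceed with, inaction occurs. $\mathcal{IS}_{br}$ is the set of instruction sequences whose basic instructions are all of the forms $\mathtt{in}{:}i.\mathtt{get}$, $\mathtt{aux}{:}i.\mathtt{get}$,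 $\mathtt{aux}{:}i.\mathtt{set{:}}b$, $\mathtt{out}.\mathtt{set{:}}b$ ($b\in\mathbb B$). $X$ computes $f:\mathbb B^n\to\mathbb B$ if for all $b_1,\dots,b_n$, executing $X$ with $\mathtt{in}{:}i$ initially $b_i$ ($i\le n$) and all auxiliary registers and $\mathtt{out}$ initially $\mathsf F$, execution never executes an instruction on $\mathtt{in}{:}i$ with $i>n$, ends by executing $!$, and leaves $f(b_1,\dots,b_n)$ in $\mathtt{out}$. *)

(* Defs.v *)
From HB Require Import structures.
From mathcomp Require Import all_boot.
From Stdlib Require Import Relation_Operators.

Set Implicit Arguments.
Unset Strict Implicit.
Unset Printing Implicit Defensive.

(* Register indices are shifted by one: [Input i] is in:(i+1) and [Aux i] is
   aux:(i+1), so that the indices i >= 1 correspond to all of [nat]. *)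
Inductive register := Input of nat | Aux of nat | Out.

Definition register_eqb (r r' : register) : bool :=
  match r, r' with
  | Input i, Input j => i == j
  | Aux i, Aux j => i == j
  | Out, Out => true
  | _, _ => false
  end.

Lemma register_eqP : Equality.axiom register_eqb.
Proof.
by case=> [i|i|] [j|j|] /=; try (by constructor);
  apply: (iffP eqP) => [-> | [->]].
Qed.

HB.instance Definition _ := hasDecEq.Build register register_eqP.

Inductive method := Set_ of bool | Get.

Inductive basic := Basic of register & method.

Inductive primitive :=
  | Plain of basic
  | PosTest of basic
  | NegTest of basic
  | Jump of nat
  | Halt.

Definition basic_of (u : primitive) : option basic :=
  match u with
  | Plain a | PosTest a | NegTest a => Some a
  | Jump _ | Halt => None
  end.

(* Positions in an instruction sequence are numbered from 0. *)
Definition basic_at (X : seq primitive) (p : nat) : option basic :=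
  obind basic_of (onth X p).

Definition occurs (a : basic) (X : seq primitive) : Prop :=
  exists p, basic_at X p = Some a.

Definition br_basic (a : basic) : bool :=
  match a with
  | Basic (Input _) Get => true
  | Basic (Aux _) _ => true
  | Basic Out (Set_ _) => true
  | _ => false
  end.

Definition IS_br (X : seq primitive) : Prop :=
  0 < size X /\ forall a, occurs a X -> br_basic a.

Definition state := register -> bool.

Definition reply (a : basic) (s : state) : bool :=
  let: Basic r m := a in
  match m with Set_ b => b | Get => s r end.

Definition effect (a : basic) (s : state) : state :=
  let: Basic r m := a in
  match m with Set_ b => [eta s with r |-> b] | Get => s end.

Definition config : Type := nat * state.

(* A configuration at [Halt] has terminated; any other configuration without
   successor (at [Jump 0], or at a position outside X) is inactive. *)
Inductive step (X : seq primitive) : config -> config -> Prop :=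
  | step_plain p s a : onth X p = Some (Plain a) ->
      step X (p, s) (p.+1, effect a s)
  | step_pos p s a : onth X p = Some (PosTest a) ->
      step X (p, s) (if reply a s then p.+1 else p.+2, effect a s)
  | step_neg p s a : onth X p = Some (NegTest a) ->
      step X (p, s) (if reply a s then p.+2 else p.+1, effect a s)
  | step_jump p s l : onth X p = Some (Jump l) -> 0 < l ->
      step X (p, s) (p + l, s).

(* The registers in:i with i > n do not belong to the initial state; the value
   given to them here is immaterial, because [computes] forbids their use. *)
Definition init n (b : n.-tuple bool) : state := fun r =>
  match r with
  | Input i => nth false b i
  | Aux _ | Out => false
  end.

Definition reachable (X : seq primitive) n (b : n.-tuple bool) (c : config)
    : Prop :=
  clos_refl_trans config (step X) (0, init b) c.

Definition computes (X : seq primitive) n (f : n.-tuple bool -> bool) : Prop :=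
  forall b : n.-tuple bool,
    (forall p s i m, reachable X b (p, s) ->
       basic_at X p = Some (Basic (Input i) m) -> i < n) /\
    (exists p s, [/\ reachable X b (p, s), onth X p = Some Halt
                   & s Out = f b]).

(* Main.v *)
(* Replace [out] by an auxiliary register v that X does not use, and translate
   every instruction into a block of three, so that jump distances are scaled
   by 3. A terminating block is [+aux:v.get; out.set:T; !]: as [out] is
   initially F and is set nowhere else, it ends up holding the content of v. *)
Require Import Defs.
From mathcomp Require Import all_boot.
From Stdlib Require Import Relation_Operators Operators_Properties.

Set Implicit Arguments.
Unset Strict Implicit.
Unset Printing Implicit Defensive.

Definition redirect v (r : register) : register :=
  if r is Out then Aux v else r.

Definition redirect_basic v (a : basic) : basic :=
  let: Basic r m := a in Basic (redirect v r) m.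

(** Blocks are entered at their first slot only. From the second slot [Jump 2] reaches the start of
    the next block; from the third, reached when a test skips, [Jump 4] reaches the block after
    that. [Jump 0] is padding. *)
Definition block v (u : primitive) : seq primitive :=
  match u with
  | Plain a => [:: Plain (redirect_basic v a); Jump 2; Jump 0]
  | PosTest a => [:: PosTest (redirect_basic v a); Jump 2; Jump 4]
  | NegTest a => [:: NegTest (redirect_basic v a); Jump 2; Jump 4]
  | Jump l => [:: Jump (l * 3); Jump 0; Jump 0]
  | Halt =>
      [:: PosTest (Basic (Aux v) Get); Plain (Basic Out (Set_ true)); Halt]
  end.

Definition translate v (X : seq primitive) : seq primitive :=
  flatten (map (block v) X).

Definition fresh v (X : seq primitive) : Prop :=
  forall r m, occurs (Basic r m) X -> r != Aux v.

(** For [r = Out] the second clause says that [Aux v] holds in [t] what [Out] holds in [s]; [Aux v]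
    itself is excluded, as its content in [s] has no counterpart. *)
Definition simulates v (s t : state) : Prop :=
  t Out = false /\ forall r, r != Aux v -> t (redirect v r) = s r.

Lemma size_translate v X : size (translate v X) = size X * 3.
Proof.
by rewrite /translate; elim: X => //= u X IH; rewrite size_cat IH; case: u.
Qed.

Lemma onth_translate v X p j : j < 3 ->
  onth (translate v X) (p * 3 + j) =
  obind (fun u => onth (block v u) j) (onth X p).
Proof.
rewrite /translate => lt_j3.
elim: X p => [|u X IH] [|p] /=; rewrite -?IH.
- by case: j lt_j3.
- by [].
- by case: u; case: j lt_j3 {IH} => [|[|[|]]].
- by case: u.
Qed.

Lemma onth_translate_at v X p u j : onth X p = Some u -> j < 3 ->
  onth (translate v X) (p * 3 + j) = onth (block v u) j.
Proof. by move=> Xp lt_j3; rewrite onth_translate // Xp. Qed.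

Lemma onth_translate0 v X p u : onth X p = Some u ->
  onth (translate v X) (p * 3) = onth (block v u) 0.
Proof. by move=> Xp; rewrite -[p * 3]addn0 (onth_translate_at _ Xp). Qed.

Lemma translate_occurs v X a : occurs a (translate v X) ->
  [\/ exists2 a', occurs a' X & a = redirect_basic v a',
      a = Basic (Aux v) Get | a = Basic Out (Set_ true)].
Proof.
case=> q; rewrite /basic_at (divn_eq q 3) onth_translate ?ltn_pmod //.
case Xp: (onth X _) => [u|] //=.
have occ a' : basic_of u = Some a' -> occurs a' X.
  by move=> ua'; exists (q %/ 3); rewrite /basic_at Xp.
case: (q %% 3) (ltn_pmod q (isT : 0 < 3)) => [|[|[|]]] // _;
  case: u occ {Xp} => [a'|a'|a'|l|] //= occ [<-];
  first [by constructor 2 | by constructor 3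
        | by constructor 1; exists a'; first exact: occ].
Qed.

Lemma fresh_exists X : exists v, fresh v X.
Proof.
suff [v lt_v] : exists v, forall i m, occurs (Basic (Aux i) m) X -> i < v.
  exists v => r m occ; apply/eqP => r_v.
  by move: occ; rewrite r_v => /lt_v; rewrite ltnn.
elim: X => [|u X [v IH]]; first by exists 0 => i m [[]].
(* A strict upper bound on the auxiliary indices, extended to cover the new head [u]. *)
exists (maxn v (if basic_of u is Some (Basic (Aux i) _) then i.+1 else 0)).
move=> i m [[|p] /=]; rewrite leq_max.
  by rewrite /basic_at /= => ->; rewrite leqnn orbT.
by move=> occ; rewrite (IH i m) //; exists p.
Qed.

Lemma simulates_reply v s t r m : r != Aux v -> simulates v s t ->
  reply (redirect_basic v (Basic r m)) t = reply (Basic r m) s.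
Proof. by move=> r_v [_ st]; case: m => //=; rewrite st. Qed.

(** The only collision of [redirect v] is between [Out] and [Aux v], so it is injective on the
    remaining registers; hence updates commute with it. *)
Lemma redirect_eq v r r' : r != Aux v -> r' != Aux v ->
  (redirect v r == redirect v r') = (r == r').
Proof.
case: r r' => [i|i|] [j|j|] // r_v r'_v; first by rewrite (negbTE r_v).
  by rewrite eq_sym (negbTE r'_v).
by rewrite !eqxx.
Qed.

Lemma simulates_effect v s t r m : r != Aux v -> simulates v s t ->
  simulates v (effect (Basic r m) s) (effect (redirect_basic v (Basic r m)) t).
Proof.
move=> r_v [t_out st]; case: m => [b|] //=; split=> [|r' r'_v] /=.
  by case: r r_v.
by rewrite redirect_eq // st.
Qed.

Lemma simulates_init v n (b : n.-tuple bool) : simulates v (init b) (init b).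
Proof. by split=> //; case. Qed.

Lemma step_inv X p s c : step X (p, s) c ->
  match onth X p with
  | Some (Plain a) => c = (p.+1, effect a s)
  | Some (PosTest a) => c = (if reply a s then p.+1 else p.+2, effect a s)
  | Some (NegTest a) => c = (if reply a s then p.+2 else p.+1, effect a s)
  | Some (Jump l) => 0 < l /\ c = (p + l, s)
  | Some Halt | None => False
  end.
Proof.
move: {-1}(p, s) (erefl (p, s)) => c0 eq_c0 stp.
by case: stp eq_c0 =>
  [p' s' a Xp|p' s' a Xp|p' s' a Xp|p' s' l Xp l_gt0] [-> ->]; rewrite Xp.
Qed.

(** Induction that adds steps at the end of a run, the form in which invariants of executions are
    proved. *)
Lemma reachable_ind X n (b : n.-tuple bool) (P : config -> Prop) :
  P (0, init b) ->
  (forall c c', reachable X b c -> P c -> step X c c' -> P c') ->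
  forall c, reachable X b c -> P c.
Proof.
move=> P0 Pstep c /clos_rt_rtn1_iff.
elim=> [//|c1 c2 st /clos_rt_rtn1_iff rch Pc1].
exact: Pstep st.
Qed.

Lemma reachable_step X n (b : n.-tuple bool) c c' :
  reachable X b c -> step X c c' -> reachable X b c'.
Proof. by move=> rch st; apply: rt_trans rch (rt_step _ _ _ _ st). Qed.

Lemma reachable_jump X n (b : n.-tuple bool) p s l q :
  reachable X b (p, s) -> onth X p = Some (Jump l) -> 0 < l -> q = p + l ->
  reachable X b (q, s).
Proof.
by move=> rch Xp l_gt0 ->; apply: reachable_step rch _; apply: step_jump.
Qed.

Lemma fresh_at v X p u r m : fresh v X -> onth X p = Some u ->
  basic_of u = Some (Basic r m) -> r != Aux v.
Proof.
by move=> frX Xp ur; apply: (frX r m); exists p; rewrite /basic_at Xp.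
Qed.

(** Forward simulation: each step of [X] is matched by a passage from one block start to another.
    This carries the terminating run of [X] over to the translation. *)
Lemma translate_reachable v X n (b : n.-tuple bool) c :
  fresh v X -> reachable X b c ->
  exists2 t, simulates v c.2 t & reachable (translate v X) b (c.1 * 3, t).
Proof.
move=> frX; move: c; apply: reachable_ind => [|c c' _ [t st rch] stp].
  by exists (init b); [exact: simulates_init | apply: rt_refl].
(* Leaving block [p] by the jump in its slot [j], which lands on the start of block [q]. *)
have Ynext p u j l t' q : onth X p = Some u -> j < 3 ->
    onth (block v u) j = Some (Jump l) -> 0 < l -> q * 3 = p * 3 + j + l ->
    reachable (translate v X) b (p * 3 + j, t') ->
    reachable (translate v X) b (q * 3, t').
  move=> Xp lt_j3 uj l_gt0 eq_q rch'; apply: reachable_jump rch' _ l_gt0 eq_q.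
  by rewrite (onth_translate_at _ Xp).
case: stp st rch => [p s [r m] Xp|p s [r m] Xp|p s [r m] Xp|p s l Xp l_gt0];
  rewrite /fst /snd => st rch;
  have := onth_translate0 v Xp; rewrite [onth (block _ _) _]/= => Yp.
- have r_v := fresh_at frX Xp erefl.
  exists (effect (redirect_basic v (Basic r m)) t).
    exact: simulates_effect.
  apply: (Ynext _ _ 1 2 _ _ Xp) => //; first by rewrite mulSn addnC -addnA.
  by rewrite addn1; apply: reachable_step rch (step_plain _ Yp).
- have r_v := fresh_at frX Xp erefl.
  exists (effect (redirect_basic v (Basic r m)) t).
    exact: simulates_effect.
  have := reachable_step rch (step_pos _ Yp).
  rewrite (simulates_reply m r_v st); case: reply => rch'.
    apply: (Ynext _ _ 1 2 _ _ Xp) => //; first by rewrite mulSn addnC -addnA.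
    by rewrite addn1.
  apply: (Ynext _ _ 2 4 _ _ Xp) => //.
    by rewrite -[p.+2]addn2 mulnDl -addnA.
  by rewrite addn2.
- have r_v := fresh_at frX Xp erefl.
  exists (effect (redirect_basic v (Basic r m)) t).
    exact: simulates_effect.
  have := reachable_step rch (step_neg _ Yp).
  rewrite (simulates_reply m r_v st); case: reply => rch'.
    apply: (Ynext _ _ 2 4 _ _ Xp) => //.
      by rewrite -[p.+2]addn2 mulnDl -addnA.
    by rewrite addn2.
  apply: (Ynext _ _ 1 2 _ _ Xp) => //; first by rewrite mulSn addnC -addnA.
  by rewrite addn1.
- exists t => //; apply: reachable_jump rch Yp _ _.
    by rewrite muln_gt0 l_gt0.
  by rewrite mulnDl.
Qed.

(** The invariant for the converse direction: the ban on reading in:i with i > n concerns every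
    reachable configuration of the translation, also inside blocks. In [tracked_hop] the step of [X]
    has been made and only the jump to its target block remains. The last two cases lie in a
    terminating block, past its test. *)
Inductive tracked v X n (b : n.-tuple bool) : config -> Prop :=
  | tracked_start p s t : reachable X b (p, s) -> simulates v s t ->
      tracked v X b (p * 3, t)
  | tracked_hop q l p s t : onth (translate v X) q = Some (Jump l) ->
      q + l = p * 3 -> reachable X b (p, s) -> simulates v s t ->
      tracked v X b (q, t)
  | tracked_output q t :
      onth (translate v X) q = Some (Plain (Basic Out (Set_ true))) ->
      onth (translate v X) q.+1 = Some Halt -> tracked v X b (q, t)
  | tracked_halt q t : onth (translate v X) q = Some Halt ->
      tracked v X b (q, t).

Lemma reachable_tracked v X n (b : n.-tuple bool) c :
  fresh v X -> reachable (translate v X) b c -> tracked v X b c.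
Proof.
move=> frX; move: c; apply: reachable_ind => [|c c' _ trk].
  apply: (@tracked_start v X n b 0 (init b)); first exact: rt_refl.
  exact: simulates_init.
case: trk => [p s t rch st|q l p s t Yq ql rch st|q t Yq YSq|q t Yq];
  last first.
- by move/step_inv; rewrite Yq.
- by move/step_inv; rewrite Yq => ->; apply: tracked_halt.
- by move/step_inv; rewrite Yq => -[_ ->]; rewrite ql; apply: tracked_start st.
have Y0 := onth_translate v X p (isT : 0 < 3).
have Y1 := onth_translate v X p (isT : 1 < 3).
have Y2 := onth_translate v X p (isT : 2 < 3).
rewrite addn0 addn1 addn2 in Y0 Y1 Y2.
(* The targets of the closing jumps: the next block from slot 1, the one after it from slot 2. *)
have eq1 : (p * 3).+1 + 2 = p.+1 * 3 by rewrite mulSn addnC addnS.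
have eq2 : (p * 3).+2 + 4 = p.+2 * 3 by rewrite !mulSn addnC !addnS.
move/step_inv; rewrite Y0.
case Xp: (onth X p) Y1 Y2 => [[[r m]|[r m]|[r m]|l|]|] // Y1 Y2.
- have r_v := fresh_at frX Xp erefl => ->.
  apply: (tracked_hop Y1 eq1).
    exact: reachable_step rch (step_plain _ Xp).
  exact: simulates_effect.
- have r_v := fresh_at frX Xp erefl => ->.
  have := reachable_step rch (step_pos _ Xp).
  rewrite (simulates_reply m r_v st); case: reply => rch'.
    by apply: (tracked_hop Y1 eq1 rch'); apply: simulates_effect.
  by apply: (tracked_hop Y2 eq2 rch'); apply: simulates_effect.
- have r_v := fresh_at frX Xp erefl => ->.
  have := reachable_step rch (step_neg _ Xp).
  rewrite (simulates_reply m r_v st); case: reply => rch'.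
    by apply: (tracked_hop Y2 eq2 rch'); apply: simulates_effect.
  by apply: (tracked_hop Y1 eq1 rch'); apply: simulates_effect.
- rewrite /= muln_gt0 => -[/andP[l_gt0 _] ->].
  rewrite -mulnDl; apply: tracked_start st.
  exact: reachable_step rch (step_jump _ Xp l_gt0).
(* In a terminating block the test of [Aux v] leads to the output instruction on reply T, and
   directly to [Halt] on reply F. *)
- by move=> ->; case: reply; [apply: tracked_output | apply: tracked_halt].
Qed.

Lemma translate_computes v X n (f : n.-tuple bool -> bool) :
  fresh v X -> computes X f -> computes (translate v X) f.
Proof.
move=> frX compX b; have [inX [p [s [rch Xp s_out]]]] := compX b; split.
  (* Among tracked positions only a block start can act on an input register, and then [X] does so
     at the corresponding reachable position. *)
  move=> q t i m /(reachable_tracked frX) trk; rewrite /basic_at.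
  inversion trk as [p' s' t' rch' _|q' l p' s' t' Yq|q' t' Yq|q' t' Yq];
    subst; try by rewrite Yq.
  rewrite -[p' * 3]addn0 onth_translate //.
  case Xp': (onth X p') => [u|] //= ui; apply: (inX p' s' i m rch').
  by rewrite /basic_at Xp' /=; case: u {Xp'} ui => //= -[[j|j|] m'].
have [t [t_out st] rchY] /= := translate_reachable frX rch.
have Y0 := onth_translate0 v Xp.
have Y1 := onth_translate_at v Xp (isT : 1 < 3).
have Y2 := onth_translate_at v Xp (isT : 2 < 3).
rewrite addn1 addn2 in Y0 Y1 Y2.
have := reachable_step rchY (step_pos _ Y0).
(* At termination of [X], [Aux v] holds the result. On T the next instruction writes it to [Out]; on
   F that instruction is skipped and [Out] is still F by [t_out]. *)
have -> : reply (Basic (Aux v) Get) t = f b by rewrite -s_out; apply: (st Out).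
case: (f b) => rchY'.
  exists (p * 3).+2, (effect (Basic Out (Set_ true)) t); split=> //.
  exact: reachable_step rchY' (step_plain _ Y1).
by exists (p * 3).+2, t.
Qed.

Theorem theorem2 :
  exists c d : nat,
    forall (n : nat) (f : n.-tuple bool -> bool) (X : seq primitive),
      IS_br X -> computes X f ->
      exists Y : seq primitive,
        [/\ IS_br Y, ~ occurs (Basic Out (Set_ false)) Y, computes Y f
          & size Y <= c * size X + d].
Proof.
exists 3, 0 => n f X [X_gt0 brX] compX.
have [v frX] := fresh_exists X; exists (translate v X); split.
- split; first by rewrite size_translate muln_gt0 X_gt0.
  move=> a /translate_occurs[[a' /brX bra' ->]|->|->] //.
  by case: a' bra' => [[i|i|] []].
(* A redirected instruction never acts on [Out], and the only instruction on [Out] that terminating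
   blocks add sets it to T. *)
- by move=> /translate_occurs[[[[i|i|] m] _]|//|//].
- exact: translate_computes.
- by rewrite size_translate mulnC addn0.
Qed.
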